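(* Let $G_1=(V_1,E_1)$ and $G_2=(V_2,E_2)$ be graphs. Then $f(G_1\boxtimes G_2)\leq f(G_1)|V_2|$ for each $f\in\{\mathrm{thin},\mathrm{pthin},\mathrm{compthin},\mathrm{comppthin},\mathrm{indthin},\mathrm{indpthin}\}$. Moreover, if $G_2$ is complete, then $f(G_1\boxtimes G_2)=f(G_1)$ for each $f\in\{\mathrm{thin},\mathrm{pthin},\mathrm{compthin},\mathrm{comppthin}\}$.
   Context: Graphs are finite, simple, undirected. The strong product $G_1\boxtimes G_2$ has vertex set $V_1\times V_2$, and distinct $(u_1,u_2)$, $(v_1,v_2)$ are adjacent iff either ($u_1=v_1$ and $u_2v_2\in E_2$), or ($u_2=v_2$ and $u_1v_1\in E_1$), or ($u_1v_1\in E_1$ and $u_2v_2\in E_2$). For a graph $G=(V,E)$, an ordering $v_1,\dots,v_n$ of $V$ and a partition of $V$ are consistent if for every $r<s<t$, whenever $v_r,v_s$ are in the same class and $v_tv_r\in E$, then $v_tv_s\in E$; strongly consistent if moreover for every $r<s<t$, whenever $v_s,v_t$ are in the same class and $v_tv_r\in E$, then $v_sv_r\in E$. $\mathrm{thin}(G)$ (resp. $\mathrm{pthin}(G)$) is the minimum number of classes of a partition of $V$ consistent (resp. strongly consistent) with some ordering of $V$. $\mathrm{indthin}$, $\mathrm{indpthin}$ are defined likewise requiring each class to be an independent set, and $\mathrm{compthin}$, $\mathrm{comppthin}$ requiring each class to be a clique. *)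

(* Defs.v *)
From mathcomp Require Import all_boot.

Set Implicit Arguments.
Unset Strict Implicit.
Unset Printing Implicit Defensive.

Record sgraph := SGraph {
  vertex :> finType;
  edge : rel vertex;
  edge_sym : symmetric edge;
  edge_irrefl : irreflexive edge
}.

Definition complete (G : sgraph) : Prop :=
  forall u v : G, u != v -> edge u v.

Section StrongProduct.
Variables G1 G2 : sgraph.

Definition sprod_edge : rel (vertex G1 * vertex G2) := fun u v =>
  (u != v) &&
  [|| (u.1 == v.1) && edge u.2 v.2,
      (u.2 == v.2) && edge u.1 v.1
    | edge u.1 v.1 && edge u.2 v.2].

Lemma sprod_edge_sym : symmetric sprod_edge.
Proof.
move=> u v; rewrite /sprod_edge (eq_sym u) (eq_sym u.1) (eq_sym u.2).
by rewrite (edge_sym u.1) (edge_sym u.2).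
Qed.

Lemma sprod_edge_irrefl : irreflexive sprod_edge.
Proof. by move=> u; rewrite /sprod_edge eqxx. Qed.

Definition strong_product : sgraph :=
  SGraph sprod_edge_sym sprod_edge_irrefl.

End StrongProduct.

Section Thinness.
Variable G : sgraph.
Implicit Types (v : {ffun 'I_#|G| -> G}) (P : {set {set G}}).

Definition same_class P (x y : G) : bool :=
  [exists A in P, (x \in A) && (y \in A)].

(* An ordering v_1, ..., v_n of the vertices is an injective (hence bijective)
   v : {ffun 'I_#|G| -> G}, indexed from 0. *)
Definition consistent v P : bool :=
  [forall r : 'I_#|G|, forall s : 'I_#|G|, forall t : 'I_#|G|,
    (r < s < t) ==> same_class P (v r) (v s) ==>
    edge (v t) (v r) ==> edge (v t) (v s)].

Definition strongly_consistent v P : bool :=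
  consistent v P &&
  [forall r : 'I_#|G|, forall s : 'I_#|G|, forall t : 'I_#|G|,
    (r < s < t) ==> same_class P (v s) (v t) ==>
    edge (v t) (v r) ==> edge (v s) (v r)].

Definition independent (A : {set G}) : bool :=
  [forall x in A, forall y in A, ~~ edge x y].

Definition clique (A : {set G}) : bool :=
  [forall x in A, forall y in A, (x != y) ==> edge x y].

Definition any_class (A : {set G}) : bool := true.

Definition has_thin_partition
    (cons : {ffun 'I_#|G| -> G} -> {set {set G}} -> bool)
    (cls : {set G} -> bool) (k : nat) : bool :=
  [exists v : {ffun 'I_#|G| -> G}, exists P : {set {set G}},
    [&& injectiveb v, partition P [set: G], cons v P,
        [forall A in P, cls A] & #|P| == k]].

(* The partition into singletons shows that all six minima are attained. *)
Lemma has_thin_partition_singletons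
    (cons : {ffun 'I_#|G| -> G} -> {set {set G}} -> bool)
    (cls : {set G} -> bool) :
  (forall v P, strongly_consistent v P -> cons v P) ->
  (forall x : G, cls [set x]) ->
  exists k, has_thin_partition cons cls k.
Proof.
move=> consP clsP; pose P := [set [set x] | x in [set: G]].
have sameP x y : same_class P x y -> x = y.
  by case/existsP=> A /andP[/imsetP[z _ ->]]; rewrite !inE => /andP[/eqP-> /eqP->].
exists #|P|; apply/existsP; exists [ffun i => enum_val i].
have inj_v : injective [ffun i : 'I_#|G| => enum_val i : G].
  by move=> i j; rewrite !ffunE => /enum_val_inj.
apply/existsP; exists P; apply/and5P; split=> //; first exact/injectiveP.
- apply/and3P; split.
  + apply/eqP/setP=> x; rewrite inE; apply/bigcupP; exists [set x].
      exact: imset_f.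
    by rewrite inE.
  + apply/trivIsetP=> _ _ /imsetP[x _ ->] /imsetP[y _ ->] neq.
    by rewrite disjoints1 inE; apply: contraNneq neq => ->.
  + by apply/imsetP=> -[x _ /setP/(_ x)]; rewrite !inE eqxx.
- apply: consP; apply/andP; split; apply/forallP=> r; apply/forallP=> s;
    apply/forallP=> t; apply/implyP=> /andP[rs st]; apply/implyP=> /sameP/inj_v eq.
  + by rewrite eq ltnn in rs.
  + by rewrite eq ltnn in st.
- by apply/forall_inP=> _ /imsetP[x _ ->].
Qed.

Lemma strongly_consistentW v P : strongly_consistent v P -> consistent v P.
Proof. by case/andP. Qed.

Lemma independent1 x : independent [set x].
Proof.
by apply/forall_inP=> y /set1P->; apply/forall_inP=> z /set1P->; rewrite edge_irrefl.
Qed.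

Lemma clique1 x : clique [set x].
Proof.
by apply/forall_inP=> y /set1P->; apply/forall_inP=> z /set1P->; rewrite eqxx.
Qed.

Definition thin : nat :=
  ex_minn (@has_thin_partition_singletons consistent any_class
             strongly_consistentW (fun=> isT)).
Definition pthin : nat :=
  ex_minn (@has_thin_partition_singletons strongly_consistent any_class
             (fun _ _ => id) (fun=> isT)).
Definition indthin : nat :=
  ex_minn (@has_thin_partition_singletons consistent independent
             strongly_consistentW independent1).
Definition indpthin : nat :=
  ex_minn (@has_thin_partition_singletons strongly_consistent independent
             (fun _ _ => id) independent1).
Definition compthin : nat :=
  ex_minn (@has_thin_partition_singletons consistent clique
             strongly_consistentW clique1).
Definition comppthin : nat :=
  ex_minn (@has_thin_partition_singletons strongly_consistent clique
             (fun _ _ => id) clique1).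

End Thinness.

(* Main.v *)
Require Import Defs.
From mathcomp Require Import all_boot.

(** An ordering with a partition is the same as an injective rank into [nat]
    with a colouring.  In the strong product, order the vertices
    lexicographically: a vertex [(a, w)] gets the colour of [a] paired with [w]
    in general, and just the colour of [a] when [G2] is complete.  In either
    case a violating triple of the product would project to a violating triple
    of [G1].  Conversely, [G1] is an induced subgraph of the product, and
    ranks and colourings restrict to induced subgraphs. *)

Set Implicit Arguments.
Unset Strict Implicit.
Unset Printing Implicit Defensive.

(** * Ranks and colourings in place of orderings and partitions *)

Section Colourings.
Variable G : sgraph.
Implicit Types (st : bool) (q : rel G).

(* [st] selects strong consistency; [q] is what distinct vertices of the same
   class must satisfy. *)
Definition thin_colouring st q (T : Type) (rk : G -> nat) (c : G -> T) : Prop :=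
  [/\ injective rk,
      forall x y z, rk x < rk y -> rk y < rk z -> c x = c y ->
        edge z x -> edge z y,
      st -> forall x y z, rk x < rk y -> rk y < rk z -> c y = c z ->
        edge z x -> edge y x
    & forall x y, x != y -> c x = c y -> q x y].

Definition thin_colourable st q (k : nat) : Prop :=
  exists (rk : G -> nat) (c : G -> 'I_k), thin_colouring st q rk c.

(** Indexing by a Boolean lets one argument serve plain and proper thinness: either value of [st]
    reduces to the original predicate, so all six minima are instances of one form by conversion. *)
Definition consistency st : {ffun 'I_#|G| -> G} -> {set {set G}} -> bool :=
  if st then @strongly_consistent G else @consistent G.

(** Only distinct vertices are compared, so cliques fit the same form as independent sets and
    arbitrary classes. *)
Definition pairwise_class (cls : {set G} -> bool) q : Type :=
  forall A : {set G}, reflect {in A &, forall x y, x != y -> q x y} (cls A).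

Lemma consistentP (v : {ffun 'I_#|G| -> G}) P :
  reflect (forall r s t : 'I_#|G|, r < s -> s < t -> same_class P (v r) (v s) ->
             edge (v t) (v r) -> edge (v t) (v s)) (consistent v P).
Proof.
apply: (iffP forallP) => [H r s t rs st sP e|H r].
  move: (H r) => /forallP/(_ s)/forallP/(_ t).
  by rewrite rs st sP e.
apply/forallP=> s; apply/forallP=> t; apply/implyP=> /andP[rs st].
by apply/implyP=> sP; apply/implyP; apply: H.
Qed.

Lemma strongly_consistentP (v : {ffun 'I_#|G| -> G}) P :
  reflect (consistent v P /\
           forall r s t : 'I_#|G|, r < s -> s < t -> same_class P (v s) (v t) ->
             edge (v t) (v r) -> edge (v s) (v r)) (strongly_consistent v P).
Proof.
apply: (iffP andP) => -[cP H]; split=> //.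
  move=> r s t rs st sP e.
  move: H => /forallP/(_ r)/forallP/(_ s)/forallP/(_ t).
  by rewrite rs st sP e.
apply/forallP=> r; apply/forallP=> s; apply/forallP=> t.
apply/implyP=> /andP[rs st].
by apply/implyP=> sP; apply/implyP; apply: H.
Qed.

Lemma consistencyP st v P :
  reflect (consistent v P /\
           (st -> forall r s t : 'I_#|G|, r < s -> s < t ->
              same_class P (v s) (v t) -> edge (v t) (v r) -> edge (v s) (v r)))
          (consistency st v P).
Proof.
case: st => /=.
  apply: (iffP (strongly_consistentP v P)) => -[cP H]; split=> //.
  by apply: H.
by apply: (iffP idP) => [cP|[]].
Qed.

Lemma any_classP : pairwise_class (@any_class G) (fun _ _ => true).
Proof. by move=> A; apply: ReflectT. Qed.

Lemma cliqueP : pairwise_class (@clique G) (@edge G).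
Proof.
move=> A; apply: (iffP forall_inP) => [H x y xA yA|H x xA].
  by move: (H x xA) => /forall_inP/(_ y yA)/implyP.
by apply/forall_inP=> y yA; apply/implyP; apply: H.
Qed.

Lemma independentP : pairwise_class (@independent G) (fun x y => ~~ edge x y).
Proof.
move=> A; apply: (iffP forall_inP) => [H x y xA yA _|H x xA].
  by move: (H x xA) => /forall_inP/(_ y yA).
apply/forall_inP=> y yA; have [->|/H->//] := eqVneq x y.
by rewrite edge_irrefl.
Qed.

(** The rank of a vertex is its position in the ordering, and its colour is the index of its block
    in [enum P]. *)
Lemma thin_partition_colourable st q cls k :
  pairwise_class cls q ->
  has_thin_partition (consistency st) cls k -> thin_colourable st q k.
Proof.
move=> clsP /existsP[v /existsP[P /and5P[/injectiveP injv partP consP]]].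
move=> /forall_inP allP /eqP <-{k}.
have [v' vK v'K] : bijective v by apply: inj_card_bij; rewrite ?card_ord.
have pbP x : pblock P x \in P by rewrite pblock_mem // (cover_partition partP).
have mem_pb x : x \in pblock P x by rewrite mem_pblock (cover_partition partP).
have ltP x : index (pblock P x) (enum P) < #|P|.
  by rewrite cardE index_mem mem_enum.
pose c x := Ordinal (ltP x).
have cP x y : c x = c y -> pblock P x = pblock P y.
  case=> eq_xy; rewrite -[LHS](nth_index set0 (s := enum P)) ?mem_enum //.
  by rewrite eq_xy nth_index ?mem_enum.
have scP x y : c x = c y -> same_class P x y.
  move=> /cP eq_xy; apply/existsP; exists (pblock P x).
  by rewrite pbP mem_pb eq_xy mem_pb.
have [/consistentP cons scons] := consistencyP st v P consP.
exists (fun x => v' x : nat), c; split=> [x y /ord_inj/(can_inj v'K)//|||].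
- move=> x y z; rewrite -(v'K x) -(v'K y) -(v'K z) !vK.
  by move=> xy yz /scP; apply: cons.
- move=> sst x y z; rewrite -(v'K x) -(v'K y) -(v'K z) !vK.
  by move=> xy yz /scP; apply: scons.
- move=> x y neq /cP eq_xy; apply: (clsP _ (allP _ (pbP x))) => //.
  by rewrite eq_xy.
Qed.

Lemma thin_colouring_partition st q cls (T : finType) (rk : G -> nat) (c : G -> T) :
  pairwise_class cls q -> thin_colouring st q rk c ->
  exists2 k, k <= #|T| & has_thin_partition (consistency st) cls k.
Proof.
move=> clsP [injrk cons scons qP].
pose s := sort (relpre rk leq) (enum G).
have size_s : size s = #|G| by rewrite size_sort -cardE.
have uniq_s : uniq s by rewrite sort_uniq enum_uniq.
have sorted_s : sorted (relpre rk leq) s.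
  by apply: sort_sorted => x y; apply: leq_total.
(* As [G] may be empty, no fixed default vertex exists; [enum_val i] supplies one from the index and
   is never reached, since [s] has size [#|G|]. *)
pose v := [ffun i : 'I_#|G| => nth (enum_val i) s i].
have vE (x0 : G) i : v i = nth x0 s i.
  by rewrite ffunE; apply: set_nth_default; rewrite size_s.
have injv : injective v.
  move=> i j; rewrite (vE (v i)) (vE (v i) j) => /eqP.
  by rewrite nth_uniq ?size_s // => /eqP/ord_inj.
have rkv (i j : 'I_#|G|) : i < j -> rk (v i) < rk (v j).
  move=> ij; rewrite ltn_neqAle; apply/andP; split.
    by apply: contraTneq ij => /injrk/injv->; rewrite ltnn.
  rewrite (vE (v i)) (vE (v i) j).
  apply: (sorted_ltn_nth (leT := relpre rk leq)) => //; rewrite ?inE ?size_s //.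
  by move=> y x z; apply: leq_trans.
pose P := preim_partition c [set: G].
have PE A : A \in P -> {in A &, forall x y, c x = c y}.
  by case/imsetP=> z _ -> x y; rewrite !inE /= => /eqP<- /eqP<-.
have sameP x y : same_class P x y -> c x = c y.
  by case/existsP=> A /and3P[/PE]; apply.
exists #|P|.
  (* Classes are indexed by the colours actually used, so there are at most [#|T|] of them. *)
  have -> : P = [set [set y | t == c y] | t in c @: [set: G]].
    rewrite -imset_comp; apply: eq_imset => x /=.
    by apply/setP=> y; rewrite !inE.
  exact: leq_trans (leq_imset_card _ _) (max_card _).
apply/existsP; exists v; apply/existsP; exists P; apply/and5P; split=> //.
- exact/injectiveP.
- exact: preim_partitionP.
- apply/consistencyP; split.
    by apply/consistentP=> i j l /rkv ij /rkv jl /sameP; apply: cons.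
  by move=> /scons sc i j l /rkv ij /rkv jl /sameP; apply: sc.
- apply/forall_inP=> A AP; apply/clsP=> x y xA yA neq.
  by apply: qP => //; apply: PE AP _ _ xA yA.
Qed.

Lemma thin_colouring_colourable st q (T : finType) (rk : G -> nat) (c : G -> T) :
  thin_colouring st q rk c -> thin_colourable st q #|T|.
Proof.
case=> injrk cons scons qP; exists rk, (enum_rank \o c); split=> //=.
- by move=> x y z xy yz /enum_rank_inj; apply: cons.
- by move=> sst x y z xy yz /enum_rank_inj; apply: scons.
- by move=> x y neq /enum_rank_inj; apply: qP.
Qed.

Lemma ex_minn_colourable st q cls
    (ex : exists k, has_thin_partition (consistency st) cls k) :
  pairwise_class cls q ->
  thin_colourable st q (ex_minn ex) /\
  forall k, thin_colourable st q k -> ex_minn ex <= k.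
Proof.
move=> clsP; case: ex_minnP => m hm minm; split.
  exact: thin_partition_colourable hm.
move=> k [rk [c /(thin_colouring_partition clsP)[k' le_k' /minm le_m]]].
by rewrite card_ord in le_k'; apply: leq_trans le_k'.
Qed.

End Colourings.

(** The factor [m] is [#|G2|] for the general bound, and 1 for both inequalities in the complete
    case. *)
Lemma ex_minn_le (G H : sgraph) st (qG : rel G) (qH : rel H) clsG clsH m
    (exG : exists k, has_thin_partition (@consistency G st) clsG k)
    (exH : exists k, has_thin_partition (@consistency H st) clsH k) :
  pairwise_class clsG qG -> pairwise_class clsH qH ->
  (forall k, thin_colourable st qG k -> thin_colourable st qH (k * m)) ->
  ex_minn exH <= ex_minn exG * m.
Proof.
move=> /(ex_minn_colourable exG)[colG _] /(ex_minn_colourable exH)[_ minH] GH.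
exact/minH/GH.
Qed.

Lemma thin_colourable_induced (G H : sgraph) st (qG : rel G) (qH : rel H)
    (f : H -> G) k :
  injective f -> (forall x y, edge (f x) (f y) = edge x y) ->
  (forall x y, x != y -> qG (f x) (f y) -> qH x y) ->
  thin_colourable st qG k -> thin_colourable st qH k.
Proof.
move=> injf fE qGH [rk [c [injrk cons scons qP]]].
exists (rk \o f), (c \o f); split=> /=.
- by move=> x y /injrk/injf.
- by move=> x y z xy yz cxy; rewrite -!fE; apply: cons cxy.
- by move=> sst x y z xy yz cyz; rewrite -!fE; apply: scons cyz.
- by move=> x y neq cxy; apply: qGH => //; apply: qP => //; rewrite (inj_eq injf).
Qed.

(** * Adjacency, lexicographic rank and colourings of the strong product *)

Section StrongProductColouring.
Variables G1 G2 : sgraph.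
Local Notation G := (strong_product G1 G2).
Local Arguments edge : simpl never.
Implicit Types u v x y z : G.

Lemma sprod_edge_neq1 u v : u.1 != v.1 ->
  edge u v = edge u.1 v.1 && ((u.2 == v.2) || edge u.2 v.2).
Proof.
move=> neq; rewrite -[LHS]/(sprod_edge u v) /sprod_edge (negbTE neq) /=.
have -> : u != v by apply: contraNneq neq => ->.
by case: (edge u.1 v.1); rewrite /= ?andbT ?andbF.
Qed.

Lemma sprod_edge_eq1 u v : u.1 = v.1 -> edge u v = edge u.2 v.2.
Proof.
case: u v => [a w] [b z] /= <-{b}.
rewrite -[LHS]/(sprod_edge (a, w) (a, z)) /sprod_edge /= eqxx /=.
rewrite (edge_irrefl a) !andbF orbF /= xpair_eqE eqxx /=.
by have [->|] := eqVneq w z; rewrite ?(edge_irrefl z) ?andbF ?orbF.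
Qed.

(** Second coordinates are always equal or adjacent here, so for distinct vertices the first
    coordinates alone decide. *)
Lemma sprod_edge_complete u v : complete G2 ->
  edge u v = (u != v) && ((u.1 == v.1) || edge u.1 v.1).
Proof.
move=> comp; have [eq1|neq1] := eqVneq u.1 v.1.
  rewrite sprod_edge_eq1 // andbT.
  case: u v eq1 => [a w] [b z] /= <-{b}; rewrite xpair_eqE eqxx /=.
  by have [->|/comp] := eqVneq w z; rewrite ?edge_irrefl.
rewrite sprod_edge_neq1 //.
have -> : u != v by apply: contraNneq neq1 => ->.
by have [_|/comp->] := eqVneq u.2 v.2; rewrite andbT.
Qed.

(** Since [enum_rank u.2] is below [#|G2|], it acts as the low digit in base [#|G2|]: the first
    coordinate dominates. *)
Definition lex_rank (rk : G1 -> nat) u : nat := rk u.1 * #|G2| + enum_rank u.2.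

Lemma lex_rank_inj rk : injective rk -> injective (lex_rank rk).
Proof.
move=> injrk [a w] [b z] eq_uv.
have G2_gt0 : 0 < #|G2| by apply: leq_ltn_trans (ltn_ord (enum_rank w)).
have eq1 : a = b.
  apply: injrk; move: (congr1 (divn^~ #|G2|) eq_uv).
  by rewrite /lex_rank /= !divnMDl // !divn_small ?addn0.
move: eq_uv; rewrite /lex_rank /= eq1 => /addnI/ord_inj/enum_rank_inj->.
by [].
Qed.

Lemma lex_rank_lt rk u v : lex_rank rk u < lex_rank rk v -> rk u.1 <= rk v.1.
Proof.
apply: contraTT; rewrite -!ltnNge => lt_vu; rewrite ltnS /lex_rank.
(* This multiple of [#|G2|] lies above every vertex of the fibre of [v.1] and not above any vertex
   of the fibre of [u.1]. *)
apply: (@leq_trans ((rk v.1).+1 * #|G2|)).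
  by rewrite mulSn addnC leq_add2r ltnW.
by apply: leq_trans (leq_addr _ _); rewrite leq_mul2r lt_vu orbT.
Qed.

Lemma lex_rank_neq rk u v : lex_rank rk u < lex_rank rk v -> u != v.
Proof. by apply: contraTneq => ->; rewrite ltnn. Qed.

Lemma lex_rank_cases rk u v : injective rk -> lex_rank rk u < lex_rank rk v ->
  u.1 = v.1 \/ v.1 != u.1 /\ rk u.1 < rk v.1.
Proof.
move=> injrk /lex_rank_lt le_uv; have [->|neq] := eqVneq u.1 v.1; first by left.
by right; rewrite ltn_neqAle le_uv (inj_eq injrk) neq.
Qed.

(** Vertices of one colour lie in the same copy of [G1], so [q] need only be checked inside a copy;
    this suits cliques and independent sets alike. *)
Lemma strong_product_colouring st (q1 : rel G1) (q : rel G) (T : Type) rk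
    (c : G1 -> T) :
  (forall a b w, a != b -> q1 a b -> q (a, w) (b, w)) ->
  thin_colouring st q1 rk c ->
  thin_colouring st q (lex_rank rk) (fun u : G => (c u.1, u.2)).
Proof.
move=> q1q [injrk cons scons qP]; split; first exact: lex_rank_inj.
- move=> [a w] [a' w'] [b z] xy yz [cxy ww]; subst w'.
  have [/= aa|/= [naa ltaa]] := lex_rank_cases injrk xy.
    by rewrite aa ltnn in xy.
  have [/= ab|/= [nab ltab]] := lex_rank_cases injrk yz.
    (* The last two vertices share a fibre. The edge to the first makes their second coordinates
       equal or adjacent, and equality would make these two vertices coincide. *)
    subst b; rewrite sprod_edge_neq1 // sprod_edge_eq1 //=.
    case/andP=> _ /orP[/eqP zw|//].
    by rewrite zw ltnn in yz.
  (* All three first coordinates now have strictly increasing ranks, so the triple projects to one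
     of [G1]. *)
  have nba : b != a.
    by apply: contraTneq (ltn_trans ltaa ltab) => ->; rewrite ltnn.
  rewrite !sprod_edge_neq1 //= => /andP[ba ->]; rewrite andbT.
  exact: cons cxy ba.
(* Mirror image: the last two vertices share a copy of [G1], and the special case is that the first
   two share a fibre. *)
- move=> sst [b z] [a w] [a' w'] xy yz [cyz ww]; subst w'.
  have [/= aa|/= [naa ltaa]] := lex_rank_cases injrk yz.
    by rewrite aa ltnn in yz.
  have [/= ab|/= [nab ltab]] := lex_rank_cases injrk xy.
    subst b; rewrite sprod_edge_neq1 // sprod_edge_eq1 //=.
    case/andP=> _ /orP[/eqP zw|//].
    by rewrite zw ltnn in xy.
  have nba : a' != b.
    by apply: contraTneq (ltn_trans ltab ltaa) => ->; rewrite ltnn.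
  rewrite !sprod_edge_neq1 //= => /andP[ba ->]; rewrite andbT.
  exact: scons cyz ba.
- move=> [a w] [b z] neq [cab wz]; subst z.
  have nab : a != b by apply: contraNneq neq => ->.
  by apply: q1q => //; apply: qP.
Qed.

(** Vertices in one fibre are adjacent twins, so a triple with two consecutive vertices in a fibre
    cannot violate consistency; any other triple projects to [G1]. A colour class contains whole
    fibres, which are cliques: the condition on [q] asks for this case too and rules out
    independence once [G2] has two vertices and [G1] is nonempty. *)
Lemma strong_product_complete_colouring st (q1 : rel G1) (q : rel G) (T : Type)
    rk (c : G1 -> T) :
  complete G2 ->
  (forall u v, u != v -> u.1 = v.1 \/ q1 u.1 v.1 -> q u v) ->
  thin_colouring st q1 rk c ->
  thin_colouring st q (lex_rank rk) (fun u : G => c u.1).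
Proof.
move=> comp q1q [injrk cons scons qP]; split; first exact: lex_rank_inj.
- move=> x y z xy yz cxy; rewrite !(sprod_edge_complete _ _ comp) => /andP[_ zx].
  rewrite eq_sym (lex_rank_neq yz) /=.
  have [<-//|[nxy ltxy]] := lex_rank_cases injrk xy.
  have [->|[nyz ltyz]] := lex_rank_cases injrk yz; first by rewrite eqxx.
  case/orP: zx => [/eqP zx|zx].
    by move: (ltn_trans ltxy ltyz); rewrite zx ltnn.
  by rewrite (cons x.1 y.1 z.1) ?orbT.
- move=> sst x y z xy yz cyz.
  rewrite !(sprod_edge_complete _ _ comp) => /andP[_ zx].
  rewrite eq_sym (lex_rank_neq xy) /=.
  have [->//|[nyz ltyz]] := lex_rank_cases injrk yz.
  have [->|[nxy ltxy]] := lex_rank_cases injrk xy; first by rewrite eqxx.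
  case/orP: zx => [/eqP zx|zx].
    by move: (ltn_trans ltxy ltyz); rewrite zx ltnn.
  by rewrite (scons sst x.1 y.1 z.1) ?orbT.
- move=> u v neq cuv; apply: q1q => //.
  by have [->|neq1] := eqVneq u.1 v.1; [left | right; apply: qP].
Qed.

(** * Bounds on the minima *)

Section Bounds.
Variables (st : bool) (q1 : rel G1) (q : rel G).
Variables (cls1 : {set G1} -> bool) (cls : {set G} -> bool).
Hypothesis cls1P : pairwise_class cls1 q1.
Hypothesis clsP : pairwise_class cls q.
Variable ex1 : exists k, has_thin_partition (@consistency G1 st) cls1 k.
Variable ex : exists k, has_thin_partition (@consistency G st) cls k.

Lemma strong_product_bound :
  (forall a b w, a != b -> q1 a b -> q (a, w) (b, w)) ->
  ex_minn ex <= ex_minn ex1 * #|G2|.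
Proof.
move=> q1q; apply: ex_minn_le cls1P clsP _ => k [rk [c col]].
have := thin_colouring_colourable (strong_product_colouring q1q col).
by rewrite card_prod card_ord.
Qed.

Lemma strong_product_complete_eq :
  0 < #|G2| -> complete G2 ->
  (forall u v, u != v -> u.1 = v.1 \/ q1 u.1 v.1 -> q u v) ->
  (forall a b w, a != b -> q (a, w) (b, w) -> q1 a b) ->
  ex_minn ex = ex_minn ex1.
Proof.
(* The vertex [w] fixes a copy of [G1] for the lower bound; an empty [G2] would make the product
   empty. *)
move=> /card_gt0P[w _] comp q1q qq1; apply/eqP; rewrite eqn_leq.
apply/andP; split; rewrite -[X in _ <= X]muln1.
  apply: ex_minn_le cls1P clsP _ => k [rk [c col]]; rewrite muln1.
  by exists (lex_rank rk), (fun u => c u.1);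
     apply: strong_product_complete_colouring col.
(* Conversely, a colouring of the product restricts to the induced copy of [G1] at height [w]. *)
apply: ex_minn_le clsP cls1P _ => k; rewrite muln1.
apply: (@thin_colourable_induced G G1 _ _ _ (fun a => (a, w))) => //.
- by move=> a b [].
- move=> a b; have [->|neq] := eqVneq a b; first by rewrite !edge_irrefl.
  by rewrite sprod_edge_neq1 //= eqxx andbT.
- by move=> a b neq; apply: qq1.
Qed.

End Bounds.
End StrongProductColouring.

Theorem theorem4p36 (G1 G2 : sgraph) :
  (thin (strong_product G1 G2) <= thin G1 * #|G2| /\
   pthin (strong_product G1 G2) <= pthin G1 * #|G2| /\
   compthin (strong_product G1 G2) <= compthin G1 * #|G2| /\
   comppthin (strong_product G1 G2) <= comppthin G1 * #|G2| /\
   indthin (strong_product G1 G2) <= indthin G1 * #|G2| /\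
   indpthin (strong_product G1 G2) <= indpthin G1 * #|G2|) /\
  (0 < #|G2| -> complete G2 ->
   thin (strong_product G1 G2) = thin G1 /\
   pthin (strong_product G1 G2) = pthin G1 /\
   compthin (strong_product G1 G2) = compthin G1 /\
   comppthin (strong_product G1 G2) = comppthin G1).
Proof.
(* Each copy of [G1] is induced, so adjacency and non-adjacency both carry over to it. *)
have layer_edge a b (w : G2) : a != b ->
    edge ((a, w) : strong_product G1 G2) (b, w) = edge a b.
  by move=> neq; rewrite sprod_edge_neq1 //= eqxx andbT.
have cliqueq (a b : G1) (w : G2) : a != b -> edge a b ->
    edge ((a, w) : strong_product G1 G2) (b, w).
  by move=> /layer_edge->.
have indq (a b : G1) (w : G2) : a != b -> ~~ edge a b ->
    ~~ edge ((a, w) : strong_product G1 G2) (b, w).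
  by move=> /layer_edge->.
split.
  split; first exact: (strong_product_bound (st := false) (@any_classP _) (@any_classP _)).
  split; first exact: (strong_product_bound (st := true) (@any_classP _) (@any_classP _)).
  split; first exact: (strong_product_bound (st := false) (@cliqueP _) (@cliqueP _)).
  split; first exact: (strong_product_bound (st := true) (@cliqueP _) (@cliqueP _)).
  split; first exact: (strong_product_bound (st := false) (@independentP _) (@independentP _)).
  exact: (strong_product_bound (st := true) (@independentP _) (@independentP _)).
move=> G2_gt0 comp.
have cliquec (u v : strong_product G1 G2) : u != v ->
    u.1 = v.1 \/ edge u.1 v.1 -> edge u v.
  by move=> neq; rewrite sprod_edge_complete // neq => -[->|->]; rewrite ?eqxx ?orbT.
have cliquer (a b : G1) (w : G2) : a != b ->
    edge ((a, w) : strong_product G1 G2) (b, w) -> edge a b.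
  by move=> /layer_edge->.
split; first exact: (strong_product_complete_eq (st := false) (@any_classP _) (@any_classP _)).
split; first exact: (strong_product_complete_eq (st := true) (@any_classP _) (@any_classP _)).
split; first exact: (strong_product_complete_eq (st := false) (@cliqueP _) (@cliqueP _)).
exact: (strong_product_complete_eq (st := true) (@cliqueP _) (@cliqueP _)).
Qed.
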